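(* Let $d\ge1$ and $n\ge1$ be integers. The set $Y_{n+d}^\circ$ is the variety of the polynomial ideal $\langle U_\alpha(x):|\alpha|=n\rangle$; that is, $Y_{n+d}^\circ$ is the set of common zeros of the polynomials $U_\alpha$, $\alpha\in\mathbb{N}_0^d$, $|\alpha|=\alpha_1+\cdots+\alpha_d=n$, regarded as polynomials in $x\in\mathbb{R}^d$.
   Context: Let $\mathbb{R}_H^{d+1}=\{\mathbf t\in\mathbb{R}^{d+1}:t_1+\cdots+t_{d+1}=0\}$, $\mathbb{H}=\{\mathbf k\in\mathbb{Z}^{d+1}:k_1+\cdots+k_{d+1}=0,\ k_1\equiv\cdots\equiv k_{d+1}\ (\mathrm{mod}\ d+1)\}$, $\phi_{\mathbf k}(\mathbf t)=e^{\frac{2\pi i}{d+1}\mathbf k\cdot\mathbf t}$. The group $S_{d+1}$ acts by permuting coordinates, $\mathbf t\mapsto\mathbf t\sigma$, and the generalized sine functions are $\mathsf{TS}_{\mathbf k}(\mathbf t)=\frac1{(d+1)!}\sum_{\sigma\in S_{d+1}}\mathrm{sgn}(\sigma)\phi_{\mathbf k}(\mathbf t\sigma)$, $\mathbf k\in\mathbb{H}$. Change of variables: $z_k=z_k(\mathbf t)=\binom{d+1}{k}^{-1}\sum_{J\subset\{1,\dots,d+1\},|J|=k}e^{2\pi i\sum_{j\in J}t_j}$, $1\le k\le d$, so $\overline{z_k}=z_{d+1-k}$. Real coordinates $x=x(\mathbf t)\in\mathbb{R}^d$: $x_k=\frac{z_k+z_{d+1-k}}2$, $x_{d+1-k}=\frac{z_k-z_{d+1-k}}{2i}$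 for $1\le k\le\lfloor d/2\rfloor$, and $x_{(d+1)/2}=\frac1{\sqrt2}z_{(d+1)/2}$ if $d$ is odd; polynomials in $z$ are regarded as polynomials in $x$ through this linear relation. Chebyshev polynomials of the second kind: for $\alpha\in\mathbb{N}_0^d$ let $\mathbf k\in\mathbb{H}$ be the unique element with $k_i-k_{i+1}=(d+1)\alpha_i$, $1\le i\le d$. With $\mathbf v^\circ=\big(\frac{d(d+1)}2,\frac{(d-2)(d+1)}2,\dots,\frac{(2-d)(d+1)}2,\frac{-d(d+1)}2\big)$, $U_\alpha$ is the polynomial in $z=(z_1,\dots,z_d)$ (of total degree $|\alpha|$) defined by $U_\alpha(z(\mathbf t))=\mathsf{TS}_{\mathbf k+\mathbf v^\circ}(\mathbf t)/\mathsf{TS}_{\mathbf v^\circ}(\mathbf t)$. For $m\ge1$ let $\Lambda_m^\circ=\{\mathbf k\in\mathbb{H}:k_{d+1}<k_d<\cdots<k_1<k_{d+1}+(d+1)m\}$ and let $Y_m^\circ=\{x(\tfrac{\mathbf j}{(d+1)m}):\mathbf j\in\Lambda_m^\circ\}\subset\mathbb{R}^d$. *)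

(* Defs.v *)
From HB Require Import structures.
From mathcomp Require Import all_boot all_order all_algebra perm.
From mathcomp Require Import all_classical all_reals all_analysis.
From mathcomp Require Import complex.
(* The notations of mpoly clash with those of MathComp-Analysis. *)
From mathcomp Require Import -(notations) mpoly.
From mathcomp Require Import ring lra zify.

Set Implicit Arguments.
Unset Strict Implicit.
Unset Printing Implicit Defensive.

Import Order.TTheory GRing.Theory Num.Theory.
Local Open Scope classical_set_scope.
Local Open Scope ring_scope.

(* Index conventions: k in {1, ..., d} is represented by i : 'I_d with
   k = i.+1, so that d + 1 - k is represented by [rev_ord i]; likewise for
   {1, ..., d + 1} and 'I_d.+1. *)

Section Defs.
Variable R : realType.
Variable d : nat.

Definition cexpi (a : R) : R[i] := Complex (cos a) (sin a).

Definition RH : set 'rV[R]_d.+1 := [set t : 'rV[R]_d.+1 | \sum_j t 0 j = 0].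

Definition HH : set 'rV[int]_d.+1 :=
  [set k : 'rV[int]_d.+1 | \sum_j k 0 j = 0 /\
     forall i j, (k 0%R i = k 0%R j %[mod d.+1%:Z])%Z].

Definition phi (k : 'rV[int]_d.+1) (t : 'rV[R]_d.+1) : R[i] :=
  cexpi (2 * pi / d.+1%:R * \sum_j (k 0 j)%:~R * t 0 j).

Definition TS (k : 'rV[int]_d.+1) (t : 'rV[R]_d.+1) : R[i] :=
  (d.+1)`!%:R^-1 * \sum_(s : 'S_d.+1) (-1) ^+ s * phi k (col_perm s t).

(* The division is exact, see [vcircE]. *)
Definition vcirc : 'rV[int]_d.+1 :=
  \row_j (((d%:Z - 2 * j%:Z) * d.+1%:Z) %/ 2)%Z.

Definition zcoord (t : 'rV[R]_d.+1) (i : 'I_d) : R[i] :=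
  ('C(d.+1, i.+1))%:R^-1 *
  \sum_(J : {set 'I_d.+1} | #|J| == i.+1) cexpi (2 * pi * \sum_(j in J) t 0 j).

Definition x_of_z (z : 'I_d -> R[i]) (i : 'I_d) : R[i] :=
  if (i < d./2)%N then (z i + z (rev_ord i)) / 2
  else if rev_ord i == i then z i / (Num.sqrt 2)%:C%C
  else (z (rev_ord i) - z i) / (2 * 'i%C).

(* The argument of [complex.Re] is real for t in RH, see [xcoordE]. *)
Definition xcoord (t : 'rV[R]_d.+1) : 'rV[R]_d :=
  \row_i complex.Re (x_of_z (zcoord t) i).

Local Notation mpX i := (mpolyX R[i] (mnm1 i)).

(* z_k as a linear form in x: the inverse of [x_of_z], see [z_of_xK] and
   [x_of_zK]. *)
Definition z_of_x (i : 'I_d) : mpoly d R[i] :=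
  if (i < d./2)%N then mpX i + 'i%C *: mpX (rev_ord i)
  else if rev_ord i == i then (Num.sqrt 2)%:C%C *: mpX i
  else mpX (rev_ord i) - 'i%C *: mpX i.

(* P(z(t)) = TS_{k + v°}(t) / TS_{v°}(t) wherever the quotient is defined,
   with k the element of HH determined by k_i - k_{i+1} = (d + 1) alpha_i. *)
Definition is_chebU (alpha : multinom d) (P : mpoly d R[i]) :=
  exists k : 'rV[int]_d.+1,
    [/\ HH k,
        forall i : 'I_d,
          k 0 (widen_ord (leqnSn d) i) - k 0 (lift ord0 i)
            = d.+1%:Z * (alpha i)%:Z &
        forall t : 'rV[R]_d.+1, RH t -> TS vcirc t != 0 ->
          meval (zcoord t) P = TS (k + vcirc) t / TS vcirc t].

(* The functional equation determines the polynomial, as z(RH) is Zariski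
   dense in C^d.  The default value 0 never satisfies [is_chebU]. *)
Definition chebU (alpha : multinom d) : mpoly d R[i] :=
  xget 0 [set P | is_chebU alpha P].

Definition chebUx (alpha : multinom d) : mpoly d R[i] :=
  comp_mpoly [tuple z_of_x i | i < d] (chebU alpha).

Definition evalx (x : 'rV[R]_d) (p : mpoly d R[i]) : R[i] :=
  meval (fun i => (x 0 i)%:C%C) p.

Definition Lambda (m : nat) : set 'rV[int]_d.+1 :=
  [set k : 'rV[int]_d.+1 |
    [/\ HH k,
        forall i j : 'I_d.+1, (i < j)%N -> k 0 j < k 0 i &
        k 0 ord0 < k 0 ord_max + d.+1%:Z * m%:Z]].

Definition Ycirc (m : nat) : set 'rV[R]_d :=
  [set xcoord (\row_i ((j 0 i)%:~R / (d.+1 * m)%:R)) | j in Lambda m].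

Definition ideal_span (S : set (mpoly d R[i])) :
    set (mpoly d R[i]) :=
  [set p | exists2 s : seq (mpoly d R[i] * mpoly d R[i]),
     (forall q, q \in s -> S q.2) & p = \sum_(q <- s) q.1 * q.2].

Definition variety (I : set (mpoly d R[i])) : set 'rV[R]_d :=
  [set x | forall p, I p -> evalx x p = 0].

Definition chebU_family (n : nat) : set (mpoly d R[i]) :=
  [set chebUx alpha | alpha in [set alpha | mdeg alpha = n]].

Lemma vcircE (j : 'I_d.+1) :
  2 * vcirc 0 j = (d%:Z - 2 * j%:Z) * d.+1%:Z.
Proof.
rewrite mxE mulrC divzK //; apply/dvdz_mod0P.
set a : int := _ * _.
suff [b ->] : exists b : int, a = b * 2 by rewrite modzMl.
exists ((d * d.+1)./2%:Z - j%:Z * d.+1%:Z).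
have /even_halfK h : ~~ odd (d * d.+1) by rewrite oddM /= andbN.
have {}h : (d * d.+1)./2%:Z * 2 = d%:Z * d.+1%:Z.
  by rewrite -PoszM -[in RHS]h -muln2 PoszM.
by rewrite mulrBl h /a; ring.
Qed.

Let two_neq0 : (2 : R[i]) != 0. Proof. by rewrite pnatr_eq0. Qed.

Let i_neq0 : ('i%C : R[i]) != 0.
Proof. by rewrite eq_complex /= oner_eq0 andbF. Qed.


Let sqrt2_neq0 : ((Num.sqrt 2)%:C%C : R[i]) != 0.
Proof. by rewrite eq_complex /= negb_and sqrtr_eq0 -ltNge ltr0n. Qed.

Let half_rev (i : 'I_d) : rev_ord i != i -> (rev_ord i < d./2)%N = ~~ (i < d./2)%N.
Proof. by rewrite -val_eqE /=; have := ltn_ord i; lia. Qed.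

Let half_mid (i : 'I_d) : (i < d./2)%N -> rev_ord i != i.
Proof. by rewrite -val_eqE /=; have := ltn_ord i; lia. Qed.

Lemma z_of_xE (x : 'I_d -> R[i]) (i : 'I_d) :
  meval x (z_of_x i) =
  if (i < d./2)%N then x i + 'i%C * x (rev_ord i)
  else if rev_ord i == i then (Num.sqrt 2)%:C%C * x i
  else x (rev_ord i) - 'i%C * x i.
Proof.
rewrite /z_of_x; case: ifP => _; last case: ifP => _.
- by rewrite mevalD mevalZ !mevalXU.
- by rewrite mevalZ !mevalXU.
- by rewrite mevalB mevalZ !mevalXU.
Qed.

Lemma z_of_xK (z : 'I_d -> R[i]) (i : 'I_d) :
  meval (x_of_z z) (z_of_x i) = z i.
Proof.
rewrite z_of_xE /x_of_z rev_ordK; case: (boolP (_ < _)%N) => hi.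
  rewrite half_rev ?half_mid// hi /= eq_sym (negbTE (half_mid hi)).
  by field; rewrite i_neq0.
case: (boolP (rev_ord i == i)) => hr; first by field.
rewrite half_rev// hi.
by field; rewrite i_neq0.
Qed.

Lemma x_of_zK (x : 'I_d -> R[i]) (i : 'I_d) :
  x_of_z (fun k => meval x (z_of_x k)) i = x i.
Proof.
rewrite /x_of_z !z_of_xE rev_ordK; case: (boolP (_ < _)%N) => hi.
  rewrite half_rev ?half_mid// hi /= eq_sym (negbTE (half_mid hi)).
  by field.
case: (boolP (rev_ord i == i)) => hr; first by field.
rewrite half_rev// hi.
by field; rewrite i_neq0.
Qed.

Lemma cexpi_conj (a : R) : (cexpi a)^*%C = cexpi (- a).
Proof. by rewrite /cexpi cosN sinN. Qed.

Lemma zcoord_conj (t : 'rV[R]_d.+1) (i : 'I_d) : RH t ->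
  (zcoord t i)^*%C = zcoord t (rev_ord i).
Proof.
move=> ht; rewrite /zcoord rmorphM fmorphV rmorph_nat rmorph_sum /=.
have hi := ltn_ord i.
have -> : ((d - i.+1).+1 = d.+1 - i.+1)%N by lia.
rewrite bin_sub; last by lia.
congr (_ * _); rewrite [RHS](reindex_inj (inv_inj (@finset.setCK _))) /=.
apply: eq_big => [J|J _].
  have := finset.cardsC J; rewrite card_ord.
  move: #|J| #|~: J| => a b hab.
  by apply/eqP/eqP => h; lia.
rewrite -[LHS]/((cexpi _)^*%C) cexpi_conj -mulrN; congr (cexpi (_ * _)).
move: ht; rewrite /RH /= (bigID (mem J)) /=.
under [X in _ + X = 0]eq_bigl => j do rewrite -finset.in_setC.
by move/eqP; rewrite addrC addr_eq0 => /eqP ->.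
Qed.

Lemma xcoordE (t : 'rV[R]_d.+1) (i : 'I_d) : RH t ->
  ((xcoord t) 0 i)%:C%C = x_of_z (zcoord t) i.
Proof.
move=> ht; rewrite mxE.
have realE (w : R[i]) : w^*%C = w -> (complex.Re w)%:C%C = w.
  by case: w => a b [] /eqP; rewrite eq_sym -addr_eq0 -mulr2n mulrn_eq0 => /eqP ->.
apply: realE; rewrite /x_of_z.
have zc k := zcoord_conj k ht.
have sqrt2_real : ((Num.sqrt 2)%:C%C^*%C : R[i]) = (Num.sqrt 2)%:C%C.
  exact: conjc_real.
have i_conj : ('i%C : R[i])^*%C = - 'i%C by apply/eqP; rewrite eq_complex /= oppr0 !eqxx.
have cD (u v : R[i]) : (u + v)^*%C = u^*%C + v^*%C by exact: rmorphD.
have cB (u v : R[i]) : (u - v)^*%C = u^*%C - v^*%C by exact: rmorphB.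
have cM (u v : R[i]) : (u * v)^*%C = u^*%C * v^*%C by exact: rmorphM.
have cF (u v : R[i]) : (u / v)^*%C = u^*%C / v^*%C by exact: fmorph_div.
have c2 : (2 : R[i])^*%C = 2 by exact: rmorph_nat.
case: ifP => _; last case: ifP => [/eqP hr|_].
- by rewrite cF cD c2 !zc rev_ordK addrC.
- by rewrite cF zc sqrt2_real hr.
- rewrite cF cB !zc cM c2 i_conj rev_ordK.
  by rewrite mulrN invrN mulrN -mulNr opprB.
Qed.

End Defs.

Arguments Lambda d m : clear implicits.
Arguments Ycirc R d m : clear implicits.
Arguments chebU_family R d n : clear implicits.

(* Main.v *)
Require Import Defs.
From mathcomp Require Import all_boot all_order all_algebra perm.
From mathcomp Require Import all_classical all_reals all_analysis.
From mathcomp Require Import complex.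
From mathcomp Require Import -(notations) mpoly.
From mathcomp Require Import ring lra zify.

Set Implicit Arguments.
Unset Strict Implicit.
Unset Printing Implicit Defensive.

Import Order.TTheory GRing.Theory Num.Theory.

Local Open Scope ring_scope.

(** For t with zero coordinate sum put u_j = e^(2 pi i t_j).  The product of the
    nodes u_j is 1, and z(t) lists their normalized elementary symmetric
    functions.  Up to the factor 1/(d+1)!, the sum TS_(k+v°)(t) is the
    bialternant det (u_i ^ mu_j), where mu is the decreasing sequence of natural
    numbers that ends at 0 and has the gaps alpha_j + 1 ([TS_shift]); in
    particular its first term is |alpha| + d, and TS_(v°) is the Vandermonde
    determinant.  So U_alpha is a Schur polynomial of the nodes.  Let m = n + d.

    Points of the lattice are zeros ([chebU_vanishes]).  At such a point the
    nodes are distinct and have a common m-th power c.  If |alpha| = n, the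
    first row of the bialternant is then c times its last row, which consists
    of ones; the numerator vanishes and the denominator does not.

    Conversely ([chebU_common_zero]), any x in R^d gives the coefficients of a
    monic polynomial q of degree d + 1 with constant term (-1)^(d+1)
    ([nodal_poly]); its roots u_j are a priori arbitrary complex numbers with
    product 1.  It suffices to look at the d exponent sequences made of m
    followed by {0, ..., d} without i, for 1 <= i <= d (hook shapes).  Replacing
    u_j ^ m by its expression through X^m mod q and expanding along the first
    row shows that the corresponding U_alpha is, up to sign, the coefficient of
    X^i in X^m mod q ([bialt_hook]).  The remainder is computed with
    indeterminate coefficients, so this is an identity between polynomials in
    z.  It is first obtained for nodes on the unit circle only, where U_alpha is
    characterized, and it extends to all nodes with product 1 by a density
    argument ([zpoint_dense]).

    Hence at a common zero X^m mod q is a constant c, that is, q divides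
    X^m - c.  As the roots of q are nonzero, they are distinct, and u_j ^ m = c
    for all j ([nodes_of_zero_remainder]).  The product of the u_j being 1,
    c^(d+1) = 1, so all the u_j are roots of unity of order dividing (d+1)m:
    that they lie on the unit circle comes for free.  Their exponents are
    congruent modulo d + 1 and sum to a multiple of (d+1)m; subtracting (d+1)m
    repeatedly from the largest one brings the sum to 0 without spoiling the
    spread, and sorting yields an element of Lambda ([nodes_lattice_point]). *)

(** * The polynomial whose roots are the nodes *)

Section NodePolynomial.
Variables (A : comNzRingType) (d : nat).
Implicit Type w : 'I_d -> A.

(** X^(d+1) - e_1 X^d + e_2 X^(d-1) - ... with e_(i+1) = C(d+1,i+1) w_i for i
    < d and e_(d+1) = 1, over any commutative ring so that the w_i may be
    indeterminates. *)
Definition nodal_poly w : {poly A} :=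
  'X^(d.+1) +
  \sum_(i < d) ((-1) ^+ i.+1 * ('C(d.+1, i.+1)%:R * w i)) *: 'X^(d - i) +
  ((-1) ^+ d.+1)%:P.

Lemma size_nodal_poly_tail w :
  (size (\sum_(i < d) ((-1) ^+ i.+1 * ('C(d.+1, i.+1)%:R * w i)) *: 'X^(d - i) +
  ((-1) ^+ d.+1)%:P)%R <= d.+1)%N.
Proof.
apply: (leq_trans (size_polyD _ _)); rewrite geq_max; apply/andP; split.
  apply: (leq_trans (size_sum _ _ _)); apply/bigmax_leqP => i _.
  by apply: (leq_trans (size_scale_leq _ _)); rewrite size_polyXn ltnS leq_subr.
by apply: (leq_trans (size_polyC_leq1 _)).
Qed.

Lemma nodal_poly_monic w : nodal_poly w \is monic.
Proof.
rewrite monicE /nodal_poly -addrA lead_coefDl ?lead_coefXn//.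
by rewrite size_polyXn ltnS size_nodal_poly_tail.
Qed.

Lemma size_nodal_poly w : size (nodal_poly w) = d.+2.
Proof.
rewrite /nodal_poly -addrA size_polyDl ?size_polyXn//.
by rewrite ltnS size_nodal_poly_tail.
Qed.

End NodePolynomial.

Lemma map_nodal_poly (A B : comNzRingType) (f : {rmorphism A -> B}) d
    (w : 'I_d -> A) :
  map_poly f (nodal_poly w) = nodal_poly (f \o w).
Proof.
rewrite /nodal_poly !rmorphD /= map_polyXn map_polyC /= rmorphXn rmorphN1.
rewrite rmorph_sum; congr (_ + _ + _); apply: eq_bigr => i _ /=.
by rewrite map_polyZ map_polyXn !rmorphM rmorphXn rmorphN1 rmorph_nat.
Qed.

Section Nodes.
Variables (F : numFieldType) (d : nat).
Implicit Types (u : 'I_d.+1 -> F) (w : 'I_d -> F).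

Definition zpoint u (i : 'I_d) : F :=
  'C(d.+1, i.+1)%:R^-1 *
  \sum_(J : {set 'I_d.+1} | #|J| == i.+1) \prod_(j in J) u j.

Lemma bin_neq0 (i : 'I_d) : ('C(d.+1, i.+1)%:R : F) != 0.
Proof. by rewrite pnatr_eq0 -lt0n bin_gt0 ltnS ltnW. Qed.

Lemma prod_XsubC_esym u :
  \prod_j ('X - (u j)%:P) =
  \sum_(k < d.+2) ((-1) ^+ k *
    \sum_(J : {set 'I_d.+1} | #|J| == k) \prod_(j in J) u j) *: 'X^(d.+1 - k).
Proof.
pose c := [tuple u j | j < d.+1].
have -> : \prod_j ('X - (u j)%:P) = \prod_(a <- c) ('X - a%:P).
  by rewrite big_tuple; apply: eq_bigr => j _; rewrite tnth_mktuple.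
set P := \prod_(a <- c) _.
have sP : size P = d.+2 by rewrite size_prod_XsubC size_tuple.
rewrite -[LHS]coefK poly_def sP (reindex_inj rev_ord_inj) /=.
apply: eq_bigr => k _; rewrite subSS mroots_coeff; congr (_ * _ *: _).
rewrite /mesym raddf_sum; apply: eq_bigr => J _ /=.
rewrite rmorph_prod; apply: eq_bigr => j _ /=.
by rewrite mevalXU tnth_mktuple.
Qed.

Lemma nodal_polyE u : \prod_j u j = 1 ->
  \prod_j ('X - (u j)%:P) = nodal_poly (zpoint u).
Proof.
move=> hu; rewrite prod_XsubC_esym big_ord_recl big_ord_recr /= subn0.
rewrite [X in _ + (_ + X) = _](_ : _ = ((-1) ^+ d.+1)%:P); last first.
  rewrite subnn expr0 alg_polyC; congr (_%:P).
  rewrite (big_pred1 [set: 'I_d.+1]%SET) ?big_setT ?hu ?mulr1// => [|J] /=.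
    by under eq_bigl do rewrite inE; rewrite hu mulr1.
  rewrite eq_sym -[X in (X == _) = _](card_ord d.+1) -finset.cardsT eq_sym.
  apply/eqP/eqP => [h|->//]; apply/eqP.
  by rewrite eqEcard finset.subsetT h leqnn.
rewrite (big_pred1 finset.set0) ?finset.big_set0 ?mulr1 ?scale1r; last first.
  by move=> J /=; rewrite cards_eq0.
rewrite addrA; congr (_ + _ + _); apply: eq_bigr => i _.
by rewrite /bump /= add1n subSS /zpoint mulVKf ?bin_neq0.
Qed.

Lemma nodal_poly_inj w w' : nodal_poly w = nodal_poly w' -> w =1 w'.
Proof.
rewrite /nodal_poly => /addIr/addrI h i.
have key v : (\sum_(i < d) ((-1) ^+ i.+1 * ('C(d.+1, i.+1)%:R * v i)) *:
    'X^(d - i) : {poly F})`_(d - i) = (-1) ^+ i.+1 * ('C(d.+1, i.+1)%:R * v i).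
  rewrite coef_sum (bigD1 i)//= coefZ coefXn eqxx mulr1 big1 ?addr0// => j ne.
  rewrite coefZ coefXn (_ : (_ == _) = false) ?mulr0//.
  apply/negbTE; apply: contra ne => /eqP e; apply/eqP/val_inj => /=.
  by have := ltn_ord i; have := ltn_ord j; lia.
have := congr1 (fun p : {poly F} => p`_(d - i)) h; rewrite !key.
by move=> /(can_inj (signrMK _)) /(mulfI (bin_neq0 i)).
Qed.

End Nodes.

Lemma nodal_poly_split (F : numClosedFieldType) d (w : 'I_d -> F) :
  exists u : 'I_d.+1 -> F, \prod_j u j = 1 /\ zpoint u =1 w.
Proof.
have [r] := closed_field_poly_normal (nodal_poly w).
rewrite (monicP (nodal_poly_monic w)) scale1r => hr.
have sr : size r = d.+1.
  by apply: succn_inj; rewrite -(size_prod_XsubC r id) -hr size_nodal_poly.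
pose u (j : 'I_d.+1) := r`_j.
have hu : nodal_poly w = \prod_j ('X - (u j)%:P).
  by rewrite hr (big_nth 0) sr big_mkord.
have u1 : \prod_j u j = 1.
  have := congr1 (fun p => p.[0]) hu.
  rewrite horner_prod /nodal_poly !hornerD hornerC hornerXn expr0n /= add0r.
  rewrite horner_sum big1 => [|i _]; last first.
    by rewrite hornerZ hornerXn expr0n subn_eq0 leqNgt ltn_ord mulr0.
  under eq_bigr do rewrite hornerXsubC sub0r.
  rewrite prodrN card_ord add0r -[LHS]mulr1.
  by move=> /(can_inj (signrMK _)) <-.
by exists u; split=> //; apply: nodal_poly_inj; rewrite -nodal_polyE.
Qed.

(** * Laurent polynomial functions *)

Section Laurent.
Variable F : fieldType.
Implicit Types (f g : F -> F) (p : {poly F}).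

(** Only the values off 0 matter, so that inversion is a Laurent function
    whatever the value given to 1/0. *)
Definition laurent f :=
  exists K p, forall a, a != 0 -> f a = p.[a] / a ^+ K.

Lemma eq_laurent f g : f =1 g -> laurent f -> laurent g.
Proof. by move=> e [K [p h]]; exists K, p => a /h; rewrite e. Qed.

Lemma laurent_poly p : laurent (horner p).
Proof. by exists 0%N, p => a _; rewrite expr0 divr1. Qed.

Lemma laurent_cst c : laurent (fun=> c).
Proof. by apply: eq_laurent (laurent_poly c%:P) => a; rewrite hornerC. Qed.

Lemma laurent_id : laurent (@id F).
Proof. by apply: eq_laurent (laurent_poly 'X) => a; rewrite hornerX. Qed.

Lemma laurent_inv : laurent (@GRing.inv F).
Proof. by exists 1%N, 1 => a _; rewrite hornerC div1r expr1. Qed.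

Lemma laurentD f g : laurent f -> laurent g -> laurent (fun a => f a + g a).
Proof.
move=> [K [p hf]] [L [q hg]]; exists (K + L)%N, (p * 'X^L + q * 'X^K) => a a0.
rewrite hf// hg// hornerD !hornerM !hornerXn exprD.
by field; rewrite !expf_neq0.
Qed.

Lemma laurentM f g : laurent f -> laurent g -> laurent (fun a => f a * g a).
Proof.
move=> [K [p hf]] [L [q hg]]; exists (K + L)%N, (p * q) => a a0.
by rewrite hf// hg// hornerM exprD invfM mulrACA.
Qed.

Lemma laurentX f n : laurent f -> laurent (fun a => f a ^+ n).
Proof.
move=> hf; elim: n => [|n ih]; first exact: laurent_cst.
by apply: eq_laurent (laurentM hf ih) => a; rewrite exprS.
Qed.

Lemma laurent_sum (I : Type) (r : seq I) (P : pred I) (f : I -> F -> F) :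
  (forall i, P i -> laurent (f i)) ->
  laurent (fun a => \sum_(i <- r | P i) f i a).
Proof.
move=> hf; elim: r => [|i r ih].
  by apply: eq_laurent (laurent_cst 0) => a; rewrite big_nil.
case Pi: (P i); last by apply: eq_laurent ih => a; rewrite big_cons Pi.
by apply: eq_laurent (laurentD (hf i Pi) ih) => a; rewrite big_cons Pi.
Qed.

Lemma laurent_prod (I : Type) (r : seq I) (P : pred I) (f : I -> F -> F) :
  (forall i, P i -> laurent (f i)) ->
  laurent (fun a => \prod_(i <- r | P i) f i a).
Proof.
move=> hf; elim: r => [|i r ih].
  by apply: eq_laurent (laurent_cst 1) => a; rewrite big_nil.
case Pi: (P i); last by apply: eq_laurent ih => a; rewrite big_cons Pi.
by apply: eq_laurent (laurentM (hf i Pi) ih) => a; rewrite big_cons Pi.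
Qed.

Lemma laurent_meval n (D : mpoly n F) (f : 'I_n -> F -> F) :
  (forall i, laurent (f i)) -> laurent (fun a => meval (f ^~ a) D).
Proof.
move=> hf; apply: eq_laurent => [a|]; first by rewrite mevalE.
apply: laurent_sum => m _; apply: laurentM; first exact: laurent_cst.
by apply: laurent_prod => i _; apply: laurentX.
Qed.

Lemma exists_nonroot p (a : nat -> F) :
  injective a -> p != 0 -> exists k, ~~ root p (a k).
Proof.
move=> ainj p0.
have /hasP[k _ hk] : has (fun k => ~~ root p (a k)) (iota 0 (size p)).
  apply/negPn/negP; rewrite -all_predC => /allP h.
  have := @max_poly_roots _ p [seq a k | k <- iota 0 (size p)] p0.
  rewrite map_inj_uniq ?iota_uniq// size_map size_iota ltnn.
  suff -> : all (root p) [seq a k | k <- iota 0 (size p)].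
    by move=> /(_ isT isT).
  by apply/allP => _ /mapP[k /h /= /negPn ? ->].
by exists k.
Qed.

Lemma poly_eq0_inj_roots p (a : nat -> F) :
  injective a -> (forall k, root p (a k)) -> p = 0.
Proof.
move=> ainj ha; apply/eqP; apply: contraT => /(exists_nonroot ainj)[k].
by rewrite ha.
Qed.

Lemma laurent_eq0 f (a : nat -> F) : laurent f -> injective a ->
  (forall k, a k != 0) -> (forall k, f (a k) = 0) ->
  forall b, b != 0 -> f b = 0.
Proof.
move=> [K [p hf]] ainj a0 fa b b0.
rewrite hf// (_ : p = 0) ?horner0 ?mul0r//.
apply: (poly_eq0_inj_roots ainj) => k.
have /eqP := fa k; rewrite hf// mulf_eq0 invr_eq0 expf_eq0 (negbTE (a0 k)).
by rewrite andbF orbF.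
Qed.

(** Laurent polynomials form an integral domain, so a product that vanishes
    identically has a vanishing factor as soon as the other one is nonzero at
    some point. *)
Lemma laurent_mul_eq0 f g b : laurent f -> laurent g ->
  (forall a, a != 0 -> f a * g a = 0) -> b != 0 -> g b != 0 ->
  (exists a : nat -> F, injective a) ->
  forall a, a != 0 -> f a = 0.
Proof.
move=> [K [p hf]] [L [q hg]] fg b0 gb [a ainj] c c0.
have : p * q * 'X = 0.
  apply: (poly_eq0_inj_roots ainj) => k; rewrite /root !hornerM hornerX.
  have [->|ak0] := eqVneq (a k) 0; first by rewrite mulr0.
  have /eqP := fg _ ak0; rewrite hf// hg// mulrACA mulf_eq0.
  by rewrite -invfM -exprD invr_eq0 expf_eq0 (negbTE ak0) andbF orbF => /eqP ->;
    rewrite mul0r.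
move=> /eqP; rewrite !mulf_eq0 polyX_eq0 orbF => /orP[]/eqP z.
  by rewrite hf// z horner0 mul0r.
by move: gb; rewrite hg// z horner0 mul0r eqxx.
Qed.

End Laurent.

(** * Bialternants and density of the unit torus *)

Section Bialternant.
Variables (F : fieldType) (d : nat).
Implicit Types (u : 'I_d.+1 -> F) (mu : 'I_d.+1 -> nat).

Definition bialt mu u : F := \det (\matrix_(j, i) u i ^+ mu j).

Definition staircase (j : 'I_d.+1) : nat := rev_ord j.

Lemma eq_bialt mu mu' u : mu =1 mu' -> bialt mu u = bialt mu' u.
Proof. by move=> e; congr (\det _); apply/matrixP => j i; rewrite !mxE e. Qed.

(** Permuting {0, ..., d} permutes the rows of the Vandermonde matrix. *)
Lemma bialt_perm (s : 'S_d.+1) u :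
  bialt (fun j => s j) u = (-1) ^+ s * bialt (fun j => j) u.
Proof.
rewrite /bialt -det_perm -det_mulmx -row_permE; congr (\det _).
by apply/matrixP => j i; rewrite !mxE.
Qed.

Lemma staircaseE : staircase =1 (fun j => perm (@rev_ord_inj d.+1) j).
Proof. by move=> j; rewrite permE. Qed.

Lemma vandermonde_neq0 u : (bialt staircase u != 0) = injectiveb u.
Proof.
rewrite (eq_bialt _ staircaseE) bialt_perm mulf_eq0 signr_eq0 /=.
have -> : bialt (fun j => j) u = \det (Vandermonde d.+1 (\row_i u i)).
  by congr (\det _); apply/matrixP => j i; rewrite !mxE.
rewrite det_Vandermonde; apply/idP/injectiveP => [h i j uij|uinj].
  apply/eqP; apply: contraNT h => /eqP nij.
  wlog lij : i j uij nij / (i < j)%N.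
    move=> W; case: (ltngtP i j) => [|lji|e]; first exact: W.
      by apply: (W j i) => //; apply/nesym.
    by case: nij; apply: val_inj.
  by rewrite (bigD1 i)//= (bigD1 j)//= !mxE uij subrr !mul0r.
apply/prodf_neq0 => i _; apply/prodf_neq0 => j lij; rewrite !mxE subr_eq0.
by apply/eqP => /uinj e; rewrite e ltnn in lij.
Qed.

Lemma laurent_bialt mu (v : 'I_d.+1 -> F -> F) :
  (forall j, laurent (v j)) -> laurent (fun a => bialt mu (v ^~ a)).
Proof.
move=> hv; apply: laurent_sum => s _; apply: laurentM; first exact: laurent_cst.
apply: laurent_prod => j _; apply: eq_laurent => [a|]; first by rewrite mxE.
exact: laurentX.
Qed.

End Bialternant.

Section Density.
Variables (F : numFieldType) (d : nat) (D : mpoly d F).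
Implicit Types (u : 'I_d.+1 -> F).

Lemma laurent_meval_zpoint (v : 'I_d.+1 -> F -> F) :
  (forall j, laurent (v j)) -> laurent (fun a => meval (zpoint (v ^~ a)) D).
Proof.
move=> hv; apply: laurent_meval => i; apply: laurentM; first exact: laurent_cst.
by apply: laurent_sum => J _; apply: laurent_prod.
Qed.

Lemma prod1_neq0 u : \prod_j u j = 1 -> forall j, u j != 0.
Proof.
by move=> u1 j; apply: contra_eq_neq u1; rewrite (bigD1 j)//= => ->;
   rewrite mul0r eq_sym oner_neq0.
Qed.

(** The factor bialt staircase makes the function vanish at all nodes of T,
    distinct or not. The nodes other than the last one are then freed from T
    one at a time: scaling node k by b / u_k and the last node by u_k / b
    keeps the product equal to 1, the function is Laurent in b, and it
    vanishes for infinitely many b in T, hence for b = u_k. *)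
Lemma zpoint_vandermonde_eq0 (T : F -> Prop) (a : nat -> F) :
    T 1 -> (forall b c, T b -> T c -> T (b / c)) ->
    (forall k, T (a k)) -> (forall k, a k != 0) -> injective a ->
    (forall u, (forall j, T (u j)) -> \prod_j u j = 1 -> injective u ->
       meval (zpoint u) D = 0) ->
  forall u, \prod_j u j = 1 -> meval (zpoint u) D * bialt (@staircase d) u = 0.
Proof.
move=> T1 Tdiv Ta a0 ainj hD.
have TM b c : T b -> T c -> T (b * c).
  by move=> hb hc; rewrite -[c]invrK -[c^-1]div1r; apply/Tdiv/Tdiv.
suff H k u : (k <= d)%N -> \prod_j u j = 1 ->
    (forall j : 'I_d.+1, (k <= j < d)%N -> T (u j)) ->
    meval (zpoint u) D * bialt (@staircase d) u = 0.
  by move=> u u1; apply: (H d) => // j; case: ltnP => //; rewrite andbF.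
elim: k u => [|k ih] u kd u1 hu.
  (* With all the nodes but the last in T, the last one is in T as well. *)
  have [->|] := eqVneq (bialt (@staircase d) u) 0; first by rewrite mulr0.
  rewrite vandermonde_neq0 => /injectiveP uinj; rewrite hD ?mul0r// => j.
  have [jd|dj] := ltnP j d; first exact: hu.
  have -> : j = ord_max by apply/val_inj/eqP; rewrite eqn_leq dj -ltnS ltn_ord.
  have /mulKf P0 : \prod_(i < d) u (widen_ord (leqnSn d) i) != 0.
    by apply/prodf_neq0 => i _; exact: prod1_neq0.
  move: (u1); rewrite big_ord_recr /= => /(canRL P0) ->; rewrite mulrC.
  by apply: Tdiv => //; apply: big_ind => // i _; apply: hu => /=.
have u0 := prod1_neq0 u1.
pose k' : 'I_d.+1 := Ordinal (ltn_trans kd (ltnSn d)).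
have nk' : ord_max != k' by rewrite -val_eqE /= gtn_eqF.
pose v (j : 'I_d.+1) b :=
  u j * (if j == k' then b / u k' else if j == ord_max then u k' / b else 1).
have lv j : laurent (v j).
  apply: laurentM; first exact: laurent_cst.
  have [_|_] := eqVneq j k'.
    by apply: laurentM; [exact: laurent_id | exact: laurent_cst].
  have [_|_] := eqVneq j ord_max; last exact: laurent_cst.
  by apply: laurentM; [exact: laurent_cst | exact: laurent_inv].
pose f b := meval (zpoint (v ^~ b)) D * bialt (@staircase d) (v ^~ b).
have lf : laurent f.
  by apply: laurentM; [exact: laurent_meval_zpoint | exact: laurent_bialt].
have vE : v ^~ (u k') =1 u.
  move=> j; rewrite /v; case: eqVneq => [->|_]; first by rewrite divff ?mulr1.
  by case: eqVneq => _; rewrite ?divff ?mulr1.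
have -> : meval (zpoint u) D * bialt (@staircase d) u = f (u k').
  rewrite /f; congr (_ * _); last first.
    by congr (\det _); apply/matrixP => i j; rewrite !mxE vE.
  apply: meval_eq => i; congr (_ * _); apply: eq_bigr => J _.
  by apply: eq_bigr => j _; rewrite vE.
apply: (laurent_eq0 lf ainj) => // l; apply: ih; first exact: ltnW.
  rewrite big_split /= u1 mul1r (bigD1 k')//= eqxx (bigD1 ord_max)//=.
  rewrite (negbTE nk') eqxx big1 ?mulr1 => [|i /andP[/negbTE -> /negbTE -> //]].
  by rewrite mulrA divfK ?divff.
move=> j /andP[kj jd]; rewrite /v.
have [->|nj] := eqVneq j k'; first by rewrite mulrCA divff ?mulr1.
rewrite (_ : (j == ord_max) = false); last by rewrite -val_eqE /= ltn_eqF.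
rewrite mulr1; apply: hu; rewrite jd andbT ltn_neqAle kj andbT.
by apply: contra nj => /eqP e; apply/eqP/val_inj.
Qed.

(** On the curve b |-> u_j b^(2j-d) the product is constant, since the
    exponents sum to 0, and two nodes coincide for finitely many b only, since
    the exponents are distinct. *)
Lemma injective_deformation u : \prod_j u j = 1 ->
  exists2 b : F, b != 0 & injective (fun j => u j * (b ^+ j / b ^+ rev_ord j)).
Proof.
move=> u1; have u0 := prod1_neq0 u1.
pose e (i j : 'I_d.+1) : nat := (i + rev_ord j)%N.
pose p (i j : 'I_d.+1) : {poly F} := u i *: 'X^(e i j) - u j *: 'X^(e j i).
have p0 i j : i != j -> p i j != 0.
  move=> nij; apply/eqP => /(congr1 (fun q : {poly F} => q`_(e i j))).
  rewrite coefB !coefZ !coefXn eqxx (_ : (e i j == e j i) = false).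
    by rewrite mulr0 subr0 mulr1 coef0 => /eqP; rewrite (negbTE (u0 i)).
  apply/negbTE; apply: contra nij => /eqP; rewrite /e /= => h.
  by apply/eqP/val_inj => /=; have := ltn_ord i; have := ltn_ord j; lia.
(* The factor X excludes b = 0. *)
have /(exists_nonroot (@mulrIn F 1 (oner_neq0 F))) [k] :
    'X * \prod_(ij : 'I_d.+1 * 'I_d.+1 | ij.1 != ij.2) p ij.1 ij.2 != 0.
  by rewrite mulf_neq0 ?polyX_eq0//; apply/prodf_neq0 => ij /p0.
move: (1 *+ k) => b; rewrite /root hornerM hornerX mulf_eq0 negb_or.
case/andP=> b0; rewrite horner_prod => /prodf_neq0 hb; exists b => // i j /eqP.
apply: contraTeq => nij; have := hb (i, j) nij; apply: contra => /= /eqP h.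
rewrite /p /e !hornerE !exprD subr_eq0 !mulrA -eqr_div ?expf_neq0//.
by rewrite -!mulrA; apply/eqP.
Qed.

(** Points z(u) with distinct nodes in T are Zariski dense among all z(u) with
    product 1. The Vandermonde factor of [zpoint_vandermonde_eq0] is removed
    along the curve of [injective_deformation], on which it is not identically
    zero. *)
Lemma zpoint_dense (T : F -> Prop) (a : nat -> F) :
    T 1 -> (forall b c, T b -> T c -> T (b / c)) ->
    (forall k, T (a k)) -> (forall k, a k != 0) -> injective a ->
    (forall u, (forall j, T (u j)) -> \prod_j u j = 1 -> injective u ->
       meval (zpoint u) D = 0) ->
  forall u, \prod_j u j = 1 -> meval (zpoint u) D = 0.
Proof.
move=> T1 Tdiv Ta a0 ainj hD u u1.
have hDV := zpoint_vandermonde_eq0 T1 Tdiv Ta a0 ainj hD.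
pose v (j : 'I_d.+1) b := u j * (b ^+ j / b ^+ rev_ord j).
have lv j : laurent (v j).
  apply: laurentM; first exact: laurent_cst.
  apply: laurentM; first exact: laurentX _ (laurent_id F).
  apply: eq_laurent (laurentX (rev_ord j) (laurent_inv F)) => b.
  by rewrite exprVn.
have v1 b : b != 0 -> \prod_j v j b = 1.
  move=> b0; rewrite big_split /= u1 mul1r big_split /= prodfV.
  rewrite (_ : \prod_j b ^+ rev_ord j = \prod_(j < d.+1) b ^+ j); last first.
    rewrite (reindex_inj rev_ord_inj); apply: eq_bigr => j _.
    by rewrite rev_ordK.
  by rewrite divff//; apply/prodf_neq0 => j _; rewrite expf_neq0.
have [b b0 vb] := injective_deformation u1.
have : meval (zpoint (v ^~ 1)) D = 0.
  apply: (laurent_mul_eq0 (laurent_meval_zpoint lv)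
    (laurent_bialt (@staircase d) lv) _ b0 _ _ (oner_neq0 F)).
  - by move=> c c0; apply: hDV; exact: v1.
  - by rewrite vandermonde_neq0; apply/injectiveP.
  - by exists a.
move=> <-; apply: meval_eq => i; congr (_ * _); apply: eq_bigr => J _.
by apply: eq_bigr => j _; rewrite /v !expr1n divr1 mulr1.
Qed.

End Density.

(** * Hook bialternants as remainders *)

Section Hooks.
Variables (F : numFieldType) (d : nat).
Implicit Types (u : 'I_d.+1 -> F) (w : 'I_d -> F) (i l : 'I_d.+1).

(** The division is carried out over the polynomial ring in w_1, ..., w_d, so
    that the coefficients of the remainder are polynomials in w. *)
Definition power_remainder (m : nat) : {poly mpoly d F} :=
  Pdiv.Ring.rmodp 'X^m (nodal_poly (fun i : 'I_d => mpolyX F (mnm1 i))).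

Lemma power_remainderP m w : exists Q : {poly F},
  'X^m = Q * nodal_poly w +
    \sum_(i < d.+1) meval w (power_remainder m)`_i *: 'X^i.
Proof.
pose q := nodal_poly (fun i : 'I_d => mpolyX F (mnm1 i)).
have qm : q \is monic := nodal_poly_monic _.
have /(congr1 (map_poly (meval w))) := Pdiv.RingMonic.rdivp_eq qm 'X^m.
rewrite map_polyXn rmorphD rmorphM /= -/(power_remainder m) map_nodal_poly /=.
move=> ->; exists (map_poly (meval w) (Pdiv.Ring.rdivp 'X^m q)); congr (_ + _).
  congr (_ * _); rewrite /nodal_poly; congr (_ + _ + _).
  by apply: eq_bigr => i _ /=; rewrite mevalXU.
have sr : (size (power_remainder m) <= d.+1)%N.
  by rewrite -ltnS -(size_nodal_poly (fun i : 'I_d => mpolyX F (mnm1 i)))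
    Pdiv.Ring.ltn_rmodp -/q monic_neq0.
have sr' : (size (map_poly (meval w) (power_remainder m)) <= d.+1)%N.
  exact: leq_trans (size_poly _ _) sr.
apply/polyP => k; rewrite coef_sum; have [kd|dk] := ltnP k d.+1; last first.
  rewrite nth_default ?(leq_trans sr')// big1// => i _.
  by rewrite coefZ coefXn gtn_eqF ?mulr0// (leq_trans (ltn_ord i)).
rewrite (bigD1 (Ordinal kd))//= coefZ coefXn eqxx mulr1 coef_map big1 ?addr0//.
move=> i /negbTE ni; rewrite coefZ coefXn -val_eqE /= in ni *.
by rewrite eq_sym ni mulr0.
Qed.

Lemma node_power m u j : \prod_j u j = 1 ->
  u j ^+ m = \sum_(i < d.+1) meval (zpoint u) (power_remainder m)`_i * u j ^+ i.
Proof.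
move=> u1; have [Q] := power_remainderP m (zpoint u).
move/(congr1 (horner^~ (u j))); rewrite hornerXn => ->.
rewrite hornerD hornerM -nodal_polyE// horner_prod (bigD1 j)//= hornerXsubC.
rewrite subrr mul0r mulr0 add0r horner_sum; apply: eq_bigr => i _.
by rewrite hornerZ hornerXn.
Qed.

(** The sequence m, d, ..., i + 1, i - 1, ..., 0: the exponents of the
    bialternant of a hook shape. *)
Definition hook (m : nat) i (j : 'I_d.+1) : nat :=
  if unlift ord0 j is Some k then lift i (rev_ord k) else m.

Definition hook_perm i : 'S_d.+1 := lift_perm ord0 i (perm (@rev_ord_inj d)).

(** The sign of the permutation that sorts the sequence [hook i i]. *)
Definition hook_sign i : F :=
  (-1) ^+ hook_perm i * (-1) ^+ perm (@rev_ord_inj d.+1).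

Lemma hook_sign_neq0 i : hook_sign i != 0.
Proof. by rewrite mulf_neq0 ?signr_eq0. Qed.

Lemma hook_permE i : hook i i =1 (fun j => hook_perm i j).
Proof.
move=> j; rewrite /hook /hook_perm; case: unliftP => [k ->|->].
  by rewrite lift_perm_lift permE.
by rewrite lift_perm_id.
Qed.

Lemma bialt_hook_small i u :
  bialt (hook i i) u = hook_sign i * bialt (@staircase d) u.
Proof.
rewrite (eq_bialt _ (hook_permE i)) (eq_bialt _ (@staircaseE d)) !bialt_perm.
by rewrite -mulrA signrMK.
Qed.

Lemma bialt_hook_eq0 i l u : l != i -> bialt (hook l i) u = 0.
Proof.
rewrite eq_sym => /unlift_some[k -> _].
apply: (determinant_alternate (neq_lift ord0 (rev_ord k))) => j.
by rewrite !mxE /hook unlift_none liftK rev_ordK.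
Qed.

(** In the first row, u_j ^ m is a combination of the u_j ^ l for l <= d with
    coefficients taken from the remainder; every l other than i already occurs
    as the exponent of a lower row and contributes nothing. *)
Lemma bialt_hook m i u : \prod_j u j = 1 ->
  bialt (hook m i) u =
  hook_sign i * meval (zpoint u) (power_remainder m)`_i *
  bialt (@staircase d) u.
Proof.
move=> u1; pose c l := meval (zpoint u) (power_remainder m)`_(l : 'I_d.+1).
have row0 k : bialt (hook k i) u = \sum_j u j ^+ k *
    cofactor (\matrix_(j, j') u j' ^+ hook 0 i j) ord0 j.
  rewrite /bialt (expand_det_row _ ord0); apply: eq_bigr => j _.
  rewrite mxE /hook unlift_none; congr (_ * (_ * \det _)).
  by apply/matrixP => a b; rewrite !mxE !liftK.
transitivity (\sum_l c l * bialt (hook l i) u).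
  rewrite row0; under eq_bigr do rewrite node_power// mulr_suml.
  rewrite exchange_big; apply: eq_bigr => l _; rewrite row0 mulr_sumr.
  by apply: eq_bigr => j _; rewrite -mulrA.
rewrite (bigD1 i)//= big1 => [|l li]; last by rewrite bialt_hook_eq0 ?mulr0.
by rewrite addr0 bialt_hook_small mulrCA mulrA.
Qed.

(** The nodal polynomial divides X^m - c. A multiple node would be a root of
    the derivative m X^(m-1), hence 0, which the product 1 forbids. *)
Lemma nodes_of_zero_remainder m u : (0 < m)%N -> \prod_j u j = 1 ->
  (forall i, i != ord0 -> meval (zpoint u) (power_remainder m)`_i = 0) ->
  injective u /\ exists c, forall j, u j ^+ m = c.
Proof.
move=> m0 u1 h; have u0 := prod1_neq0 u1.
set c := meval (zpoint u) (power_remainder m)`_(ord0 : 'I_d.+1).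
split; last first.
  exists c => j; rewrite node_power// (bigD1 ord0)//= big1.
    by rewrite addr0 expr0 mulr1.
  by move=> i i0; rewrite h ?mul0r.
have [Q] := power_remainderP m (zpoint u).
rewrite (bigD1 ord0)//= big1 ?addr0 => [|i i0]; last by rewrite h ?scale0r.
rewrite expr0 alg_polyC -nodal_polyE// => hQ i j uij.
apply/eqP; apply: contraT => nij.
move: hQ; rewrite (bigD1 i)//= (bigD1 j) 1?eq_sym//= -uij.
(* The factor (X - u_i)^2 makes the derivative of the product vanish at u_i. *)
move/(congr1 (fun p => (p^`()).[u i])).
rewrite derivD derivXn derivC addr0 derivM derivM derivM derivXsubC.
set S := \prod_(_ < _ | _) _; rewrite hornerMn hornerXn !hornerE subrr.
rewrite /= !(mul0r, mulr0, addr0, add0r) => /eqP; rewrite mulrn_eq0 expf_eq0.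
by rewrite (negbTE (u0 i)) andbF orbF (gtn_eqF m0).
Qed.

End Hooks.

(** * Balancing and sorting the exponents *)

Section Balancing.
Variables (d : nat).
Implicit Types (k : 'I_d.+1 -> int).

(** Subtracting M from the largest k_i lowers the sum by M and keeps all
    differences below M, because the largest value is attained once. *)
Lemma balanced_representatives (M : nat) k (r : nat) :
    injective k -> (forall i j, k i - k j < M%:Z) -> \sum_i k i = r%:Z * M%:Z ->
  exists k', [/\ injective k', forall i j, k' i - k' j < M%:Z, \sum_i k' i = 0 &
    forall i, exists e : int, k i = k' i + e * M%:Z].
Proof.
elim: r k => [|r ih] k kinj kM ks.
  exists k; split=> // i.
  by exists 0; rewrite mul0r addr0.
pose i0 := [arg max_(i > ord0) k i]%O.
have i0max i : k i <= k i0 by rewrite /i0; case: arg_maxP => //= j _; apply.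
have i0lt i : i != i0 -> k i < k i0.
  by move=> ni; rewrite lt_neqAle i0max andbT; apply: contra ni => /eqP/kinj ->.
pose k1 i := if i == i0 then k i - M%:Z else k i.
have [||//|k' [k'inj k'M k's k'E]] := ih k1.
- move=> i j; rewrite /k1; case: eqVneq => [->|ni]; case: eqVneq => [->|nj] //.
  + by have := kM i0 j; move=> + e; rewrite -e; lia.
  + by have := kM i0 i; move=> + e; rewrite e; lia.
  + exact: kinj.
- move=> i j; rewrite /k1; case: eqVneq => [->|ni]; case: eqVneq => [->|nj] //.
  + by have := kM i0 i0; lia.
  + by have := kM i0 j; lia.
  + by have := i0lt i ni; lia.
- move: ks; rewrite (bigD1 i0)//= => ks; rewrite (bigD1 i0)//= /k1 eqxx.
  rewrite (eq_bigr k) => [|i /negbTE -> //].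
  by move: ks; move: (\sum_(_ < _ | _) _) => S; nia.
exists k'; split=> // i; have [e] := k'E i; rewrite /k1.
case: eqVneq => [->|_] h; last by exists e.
by exists (e + 1); rewrite mulrDl mul1r addrA -h subrK.
Qed.

Lemma decreasing_reordering k : injective k ->
  exists s : 'S_d.+1, forall i j : 'I_d.+1, (i < j)%N -> k (s j) < k (s i).
Proof.
move=> kinj; pose t := [tuple - k i | i < d.+1].
have tu : uniq t.
  rewrite map_inj_uniq ?enum_uniq// => i j /oppr_inj; exact: kinj.
have [s hs] := tuple_permP (permEl (perm_sort <=%O t)).
exists s => i j ij; have ss : sorted <%O (sort <=%O t).
  by rewrite lt_sorted_uniq_le sort_uniq tu sort_sorted//; exact: le_total.
have sn (l : 'I_d.+1) : nth 0 (sort <=%O t) l = - k (s l).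
  by rewrite hs nth_mktuple tnth_mktuple.
rewrite -ltrN2 -!sn; apply: (sorted_ltn_nth lt_trans) => //.
  by rewrite inE size_sort size_tuple.
by rewrite inE size_sort size_tuple.
Qed.

End Balancing.

(** * Exponentials and generalized sines *)

Section Exponentials.
Variable R : realType.
Implicit Types a b : R.

Lemma cexpi0 : cexpi (0 : R) = 1.
Proof. by rewrite /cexpi cos0 sin0. Qed.

Lemma cexpiD a b : cexpi (a + b) = cexpi a * cexpi b.
Proof.
by apply/eqP; rewrite eq_complex /= cosD sinD eqxx /= addrC eqxx.
Qed.

Lemma cexpi_neq0 a : cexpi a != 0.
Proof.
have : cexpi (- a) * cexpi a = 1 by rewrite -cexpiD addNr cexpi0.
by apply: contra_eq_neq => ->; rewrite mulr0 eq_sym oner_neq0.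
Qed.

Lemma cexpiN a : cexpi (- a) = (cexpi a)^-1.
Proof.
apply: (mulIf (cexpi_neq0 a)); rewrite mulVf ?cexpi_neq0//.
by rewrite -cexpiD addNr cexpi0.
Qed.

Lemma cexpi_sum (I : finType) (P : pred I) (f : I -> R) :
  cexpi (\sum_(i | P i) f i) = \prod_(i | P i) cexpi (f i).
Proof. exact: (big_morph _ cexpiD cexpi0). Qed.

Lemma cexpiMn a n : cexpi (a *+ n) = cexpi a ^+ n.
Proof.
elim: n => [|n ih]; first by rewrite mulr0n cexpi0.
by rewrite mulrS cexpiD ih exprS.
Qed.

Lemma cexpi_turn : cexpi (2 * pi : R) = 1.
Proof.
by rewrite mulr_natl -[_ *+ 2]add0r /cexpi cosD2pi sinD2pi cos0 sin0.
Qed.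

Lemma cexpi_turns (z : int) : cexpi (2 * pi * z%:~R : R) = 1.
Proof.
case: z => n; first by rewrite -pmulrn mulr_natr cexpiMn cexpi_turn expr1n.
rewrite NegzE mulrNz mulrN cexpiN -pmulrn mulr_natr cexpiMn cexpi_turn.
by rewrite expr1n invr1.
Qed.

Lemma cexpi_neq1 a : 0 < a < 2 * pi -> cexpi a != 1.
Proof.
move=> /andP[a0 a2]; apply/eqP => -[] + _.
have s0 : 0 < sin (a / 2) by apply: sin_gt0_pi; rewrite divr_gt0//=; lra.
have -> : a = (a / 2) *+ 2 by rewrite -mulr_natr divfK.
rewrite cos_mulr2n; have := cos2Dsin2 (a / 2); nra.
Qed.

Lemma cexpi_primitive_root n : (0 < n)%N ->
  n.-primitive_root (cexpi (2 * pi / n%:R : R)).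
Proof.
move=> n0; have nR : (0 : R) < n%:R by rewrite ltr0n.
apply/andP; split=> //; apply/forallP => i.
rewrite unity_rootE -cexpiMn; have [->|ni] := eqVneq i.+1 n.
  by rewrite -[_ *+ n]mulr_natr divfK ?(lt0r_neq0 nR)// cexpi_turn !eqxx.
apply/eqP/negbTE/cexpi_neq1; rewrite -[_ *+ i.+1]mulr_natr.
have p0 := pi_gt0 R; apply/andP; split.
  by rewrite !mulr_gt0 ?invr_gt0.
rewrite mulrAC ltr_pdivrMr// ltr_pM2l ?mulr_gt0// ltr_nat.
by rewrite ltn_neqAle ni ltn_ord.
Qed.

Definition on_circle (x : R[i]) := exists a, x = cexpi (2 * pi * a).

Lemma on_circle_div x y : on_circle x -> on_circle y -> on_circle (x / y).
Proof.
by move=> [a ->] [b ->]; exists (a - b); rewrite mulrBr cexpiD cexpiN.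
Qed.

Lemma cexpi_inj_seq : injective (fun k : nat => cexpi (pi / k.+1%:R : R)).
Proof.
have p0 := pi_gt0 R.
have h (k : nat) : (pi / k.+1%:R : R) \in `[0, pi]%R.
  rewrite in_itv /=; apply/andP; split; first by rewrite divr_ge0 ?ltW.
  by rewrite ler_pdivrMr ?ltr0Sn// ler_peMr ?ler1n// ltW.
move=> k l [] /(cos_inj (h k) (h l)) + _.
by move=> /(mulfI (lt0r_neq0 p0))/invr_inj/eqP; rewrite eqr_nat => /eqP[].
Qed.

Lemma cexpi_on_circle a : on_circle (cexpi a).
Proof.
exists (a / (2 * pi)); congr cexpi; rewrite mulrC divfK//.
by rewrite mulf_neq0 ?pnatr_eq0// gt_eqF ?pi_gt0.
Qed.

End Exponentials.

Section Nodes.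
Variables (R : realType) (d : nat).
Implicit Types (t : 'rV[R]_d.+1) (mu : 'I_d.+1 -> nat).

Definition node t (j : 'I_d.+1) : R[i] := cexpi (2 * pi * t 0 j).

Lemma zcoordE t : zcoord t =1 zpoint (node t).
Proof.
move=> i; congr (_ * _); apply: eq_bigr => J _.
by rewrite mulr_sumr cexpi_sum.
Qed.

Lemma prod_node t : RH t -> \prod_j node t j = 1.
Proof. by move=> ht; rewrite -cexpi_sum -mulr_sumr ht mulr0 cexpi0. Qed.

(** The constant c is invisible since the coordinates of t sum to 0, and the
    factor d + 1 cancels the one in the definition of [phi]. *)
Lemma TS_bialt (k : 'rV[int]_d.+1) mu (c : int) t : RH t ->
  (forall j, k 0 j = d.+1%:Z * (mu j)%:Z - c) ->
  TS k t = (d.+1)`!%:R^-1 * bialt mu (node t).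
Proof.
move=> ht hk; congr (_ * _); apply: eq_bigr => s _; congr (_ * _).
rewrite /phi; transitivity (cexpi (\sum_j 2 * pi * t 0 (s j) *+ mu j)).
  have -> : \sum_j (k 0 j)%:~R * (col_perm s t) 0 j =
      d.+1%:R * \sum_j t 0 (s j) *+ mu j.
    transitivity (\sum_j (d.+1%:R * (t 0 (s j) *+ mu j) - c%:~R * t 0 (s j))).
      apply: eq_bigr => j _; rewrite hk mxE rmorphB rmorphM /= mulrBl -!pmulrn.
      by rewrite -mulrA (mulr_natl (t 0 (s j))).
    rewrite sumrB -!mulr_sumr (_ : \sum_j t 0 (s j) = 0) ?mulr0 ?subr0//.
    by rewrite -[RHS]ht [RHS](reindex_inj (@perm_inj _ s)).
  rewrite mulrA divfK ?pnatr_eq0// mulr_sumr; congr cexpi.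
  by apply: eq_bigr => j _; rewrite mulrnAr.
rewrite cexpi_sum; apply: eq_bigr => j _.
by rewrite mxE cexpiMn.
Qed.

End Nodes.

(** * Chebyshev polynomials as quotients of bialternants *)

Section Exponents.
Variable d : nat.
Implicit Types (mu : 'I_d.+1 -> nat) (alpha : multinom d).

(** The numbers mu_j - (d - j) are the parts of the partition, up to a
    constant, whose consecutive differences are the alpha_j. *)
Definition gaps mu alpha := forall i : 'I_d,
  mu (widen_ord (leqnSn d) i) = ((alpha i).+1 + mu (lift ord0 i))%N.

Lemma consecutive_eq (f : 'I_d.+1 -> int) :
  (forall i : 'I_d, f (widen_ord (leqnSn d) i) = f (lift ord0 i)) ->
  forall j, f j = f ord0.
Proof.
move=> hf [j]; elim: j => [|j ih] hj; first by congr f; apply: val_inj.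
rewrite -(ih (ltnW hj)); have := hf (Ordinal (hj : (j < d)%N)).
by move=> e; apply/esym; move: e; congr (_ = _); congr f; apply: val_inj.
Qed.

Lemma gaps_total mu alpha :
  gaps mu alpha -> mu ord0 = (mdeg alpha + d + mu ord_max)%N.
Proof.
move=> h; pose M k := mu (inord k).
have tele e (g : nat -> nat) :
    (forall k, (k < e)%N -> M k = ((g k).+1 + M k.+1)%N) ->
    M 0%N = (\sum_(k < e) g k + e + M e)%N.
  elim: e => [|e ih] hg; first by rewrite big_ord0.
  rewrite ih => [|k ke]; last exact/hg/ltnW.
  by rewrite big_ord_recr /= hg//; lia.
pose g k := if insub k is Some i then alpha (i : 'I_d) else 0%N.
have gE (i : 'I_d) : g i = alpha i by rewrite /g valK.
have -> : mdeg alpha = (\sum_(k < d) g k)%N.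
  by rewrite mdegE; apply: eq_bigr => i _; rewrite gE.
have := tele d g.
have -> : M 0%N = mu ord0 by congr mu; apply: val_inj; rewrite /= inordK.
have -> : M d = mu ord_max by congr mu; apply: val_inj; rewrite /= inordK.
apply=> k kd; rewrite -[k]/(val (Ordinal kd)) gE.
have -> : M (Ordinal kd) = mu (widen_ord (leqnSn d) (Ordinal kd)).
  by congr mu; apply: val_inj; rewrite /= inordK// ltnW.
by rewrite h; congr (_ + mu _)%N; apply: val_inj; rewrite /= inordK.
Qed.

Lemma gaps_exists alpha : exists2 mu, gaps mu alpha & mu ord_max = 0%N.
Proof.
exists (fun j => \sum_(l < d | (j <= l)%N) (alpha l).+1)%N => [i|].
  rewrite (bigD1 i)//=; congr (_ + _)%N; apply: eq_bigl => l.
  by rewrite /bump /= add1n [RHS]ltn_neqAle andbC eq_sym -val_eqE.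
by rewrite big1// => l; rewrite leqNgt ltn_ord.
Qed.

Lemma hookE m (i j : 'I_d.+1) :
  hook m i j = if j == 0%N :> nat then m else bump i (d - j).
Proof.
rewrite /hook; case: unliftP => [k ->|->//].
by rewrite /= {2 3}/bump /= add1n.
Qed.

Lemma hook_gaps n (i : 'I_d.+1) : (0 < n)%N -> i != ord0 ->
  exists2 alpha, mdeg alpha = n & gaps (hook (n + d) i) alpha.
Proof.
move=> n0 i0; pose mu := hook (n + d) i.
pose alpha := Multinom
  [tuple (mu (widen_ord (leqnSn d) j) - mu (lift ord0 j)).-1 | j < d].
have {}i0 : (0 < i)%N by rewrite lt0n.
have g : gaps mu alpha.
  move=> j; rewrite /alpha mnmE /mu !hookE /= /bump /=.
  by have := ltn_ord j; have := ltn_ord i; case: eqP => [->|]; lia.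
exists alpha => //; have := gaps_total g; rewrite /mu !hookE /=.
by rewrite subnn /bump; have := ltn_ord i; case: eqP => /=; lia.
Qed.

End Exponents.

Section Chebyshev.
Variables (R : realType) (d : nat).
Implicit Types (t : 'rV[R]_d.+1) (mu : 'I_d.+1 -> nat) (alpha : multinom d).

Lemma staircase_step (i : 'I_d) :
  staircase (widen_ord (leqnSn d) i) = (staircase (lift ord0 i)).+1.
Proof. by rewrite /staircase /= /bump /= add1n !subSS subnSK. Qed.

(** Arguments of all nodes but the last are chosen freely, and the last
    coordinate is defined by the zero sum; the product 1 then forces the last
    node. *)
Lemma circle_nodes (u : 'I_d.+1 -> R[i]) :
  (forall j, on_circle (u j)) -> \prod_j u j = 1 ->
  exists2 t, RH t & node t =1 u.
Proof.
move=> /choice[a ha] u1.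
pose t : 'rV[R]_d.+1 :=
  \row_j (if j == ord_max then - \sum_(l | l != ord_max) a l else a j).
have tE j : j != ord_max -> node t j = u j.
  by move=> /negbTE nj; rewrite /node mxE nj -ha.
have ht : RH t.
  rewrite /RH /= (bigD1 ord_max)//= mxE eqxx addrC; apply/eqP; rewrite subr_eq0.
  by apply/eqP/eq_bigr => l /negbTE nl; rewrite mxE nl.
exists t => // j; have [->|] := eqVneq j ord_max; last exact: tE.
have : \prod_j node t j = \prod_j u j by rewrite prod_node.
rewrite (bigD1 ord_max)//= [RHS](bigD1 ord_max)//=.
have P0 : \prod_(l | l != ord_max) u l != 0.
  by apply/prodf_neq0 => l _; exact: prod1_neq0 u1 l.
by rewrite (eq_bigr u tE) => /(mulIf P0).
Qed.

Lemma vcirc_staircase : exists c : int, forall j,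
  vcirc d 0 j = d.+1%:Z * (staircase j)%:Z - c.
Proof.
exists (d.+1%:Z * d%:Z - vcirc d 0 ord0) => j.
have := vcircE j; have := vcircE (@ord0 d); rewrite /staircase /= => h0 hj.
by have := ltn_ord j; rewrite subSS => jd; nia.
Qed.

(** The differences determine k up to a constant vector, which is all that
    matters for t with zero sum. *)
Lemma TS_shift (k : 'rV[int]_d.+1) mu alpha t : RH t ->
  (forall i : 'I_d, k 0 (widen_ord (leqnSn d) i) - k 0 (lift ord0 i)
     = d.+1%:Z * (alpha i)%:Z) ->
  gaps mu alpha ->
  TS (k + vcirc d) t = (d.+1)`!%:R^-1 * bialt mu (node t).
Proof.
move=> ht hk hmu; have [c hc] := vcirc_staircase.
pose f j := d.+1%:Z * (mu j)%:Z - (k + vcirc d) 0 j.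
have fE : forall j, f j = f ord0.
  apply: consecutive_eq => i; rewrite /f.
  have kE j : (k + vcirc d) 0 j = k 0 j + (d.+1%:Z * (staircase j)%:Z - c).
    by rewrite mxE hc.
  rewrite !kE (hmu i) (staircase_step i); have := hk i.
  move: (k 0 _) (k 0 _) (mu _) (staircase _) => a b m s; nia.
apply: (@TS_bialt _ _ _ _ (f ord0)) => // j.
by rewrite -(fE j) /f subKr.
Qed.

Lemma TS_vcirc t : RH t ->
  TS (vcirc d) t = (d.+1)`!%:R^-1 * bialt (@staircase d) (node t).
Proof. by move=> ht; have [c hc] := vcirc_staircase; exact: TS_bialt hc. Qed.

Lemma TS_vcirc_neq0 t : RH t -> (TS (vcirc d) t != 0) = injectiveb (node t).
Proof.
move=> ht; rewrite TS_vcirc// mulf_eq0 invr_eq0 pnatr_eq0 eqn0Ngt fact_gt0 /=.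
exact: vandermonde_neq0.
Qed.

Lemma is_chebU_bialt alpha P mu t : is_chebU alpha P -> gaps mu alpha ->
  RH t -> injective (node t) ->
  meval (zpoint (node t)) P * bialt (@staircase d) (node t) = bialt mu (node t).
Proof.
move=> [k [_ hk hP]] hmu ht /injectiveP tinj.
have V0 : TS (vcirc d) t != 0 by rewrite TS_vcirc_neq0.
have := hP t ht V0; rewrite (TS_shift ht hk hmu) TS_vcirc// => h.
rewrite -(meval_eq P (zcoordE t)) h.
by rewrite invfM invrK mulrACA mulVf ?mul1r ?divfK ?vandermonde_neq0.
Qed.

(** The index k is (d+1) lambda_j - |lambda| with lambda_j = mu_j - (d - j):
    the shift by |lambda| makes its coordinates sum to 0. *)
Lemma bialt_is_chebU alpha P mu : gaps mu alpha ->
  (forall t, RH t -> bialt mu (node t) =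
     meval (zpoint (node t)) P * bialt (@staircase d) (node t)) ->
  is_chebU alpha P.
Proof.
move=> hmu hP; pose lam (j : 'I_d.+1) : int := (mu j)%:Z - (staircase j)%:Z.
pose k : 'rV[int]_d.+1 := \row_j (lam j * d.+1%:Z - \sum_l lam l).
have hk i : k 0 (widen_ord (leqnSn d) i) - k 0 (lift ord0 i)
     = d.+1%:Z * (alpha i)%:Z.
  rewrite !mxE /lam (hmu i) (staircase_step i).
  by move: (\sum_l _) (mu _) (staircase _) => a m s; nia.
exists k; split=> // [|t ht V0].
  split=> [|i j]; last by rewrite !mxE !modzMDl.
  under eq_bigr do rewrite mxE.
  by rewrite sumrB -mulr_suml sumr_const card_ord -mulr_natr natz subrr.
rewrite (TS_shift ht hk hmu) (meval_eq P (zcoordE t)) hP//.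
move: V0; rewrite TS_vcirc// mulf_eq0 negb_or => /andP[f0 V0].
by rewrite -mulf_div divff// mul1r mulfK.
Qed.

Lemma chebUP alpha (P : mpoly d R[i]) :
  is_chebU alpha P -> is_chebU alpha (chebU R alpha).
Proof. by move=> hP; rewrite /chebU; case: xgetP => [Q _ //|/(_ P)/(_ hP)]. Qed.

End Chebyshev.

(** * Lattice points are common zeros *)

Section Variety.
Variables (R : realType) (d : nat).
Implicit Types (u : 'I_d.+1 -> R[i]) (alpha : multinom d) (x : 'rV[R]_d).

Lemma evalx_chebUx x alpha :
  evalx x (chebUx R alpha) =
  meval (fun i => meval (fun k => (x 0 k)%:C%C) (z_of_x R i)) (chebU R alpha).
Proof.
rewrite /evalx /chebUx comp_mpoly_meval; apply: meval_eq => i.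
by rewrite tnth_mktuple.
Qed.

Lemma z_of_xcoord (t : 'rV[R]_d.+1) i : RH t ->
  meval (fun k => (xcoord t 0 k)%:C%C) (z_of_x R i) = zpoint (node t) i.
Proof.
move=> ht; rewrite -(zcoordE t) -[RHS]z_of_xK; apply: meval_eq => k.
exact: xcoordE.
Qed.

(** The combination of the first and the last row that vanishes gives a kernel
    vector. *)
Lemma bialt_eq0 m c (mu : 'I_d.+1 -> nat) u : (0 < d)%N ->
  mu ord0 = m -> mu ord_max = 0%N -> (forall j, u j ^+ m = c) -> bialt mu u = 0.
Proof.
move=> d0 mu0 mud uc; apply/eqP/det0P.
exists (delta_mx 0 ord0 - c *: delta_mx 0 ord_max).
  apply/eqP => /matrixP/(_ 0 ord0)/eqP; rewrite !mxE !eqxx /=.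
  by rewrite -[ord0 == _]val_eqE /= ltn_eqF// mulr0 subr0 oner_eq0.
rewrite mulmxBl -scalemxAl -!rowE; apply/rowP => j.
by rewrite !mxE mu0 mud expr0 uc mulr1 subrr.
Qed.

Section LatticePoint.
Variables (m : nat) (j : 'rV[int]_d.+1).
Hypotheses (m0 : (0 < m)%N) (hj : Lambda d m j).

Definition lattice_point : 'rV[R]_d.+1 := \row_i ((j 0 i)%:~R / (d.+1 * m)%:R).

Lemma RH_lattice_point : RH lattice_point.
Proof.
have [[js _] _ _] := hj; rewrite /RH /=.
under eq_bigr do rewrite mxE; rewrite -mulr_suml -rmorph_sum /= js.
by rewrite mul0r.
Qed.

Lemma node_lattice_point i : node lattice_point i =
  cexpi (2 * pi / (d.+1 * m)%:R * (j 0 i)%:~R).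
Proof. by rewrite /node mxE; congr cexpi; rewrite mulrA mulrAC. Qed.

Lemma node_lattice_point_pow i l :
  node lattice_point i ^+ m = node lattice_point l ^+ m.
Proof.
have [[_ jm] _ _] := hj; have /eqP := jm i l.
rewrite eqz_mod_dvd => /dvdzP[e] /(canRL (subrK _)) jE.
rewrite !node_lattice_point -!cexpiMn jE intrD intrM mulrDr mulrnDl cexpiD.
rewrite (_ : _ *+ m = 2 * pi * e%:~R) ?cexpi_turns ?mul1r//.
rewrite -[_ *+ m]mulr_natr natrM -[(Posz d.+1)%:~R]pmulrn.
by field; rewrite nat1r !pnatr_eq0 -lt0n m0.
Qed.

(** The exponents are strictly decreasing with spread less than (d+1)m, so two
    of the nodes differ by less than a full turn. *)
Lemma node_lattice_point_inj : injective (node lattice_point).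
Proof.
have [_ jd jb] := hj; move=> i l /eqP; apply: contraTeq.
wlog il : i l / (i < l)%N.
  move=> W nil; have [h|h|/val_inj e] := ltngtP i l; first exact: W.
    by rewrite eq_sym W// eq_sym.
  by rewrite e eqxx in nil.
move=> _; rewrite !node_lattice_point -[X in _ != X]mul1r.
pose a := 2 * pi / (d.+1 * m)%:R * (j 0 i - j 0 l)%:~R : R.
have -> : 2 * pi / (d.+1 * m)%:R * (j 0 i)%:~R =
    a + 2 * pi / (d.+1 * m)%:R * (j 0 l)%:~R.
  by rewrite /a rmorphB -mulrDr subrK.
rewrite cexpiD (inj_eq (mulIf (cexpi_neq0 _))) cexpi_neq1// /a.
have le (k : 'I_d.+1) : j 0 ord_max <= j 0 k <= j 0 ord0.
  apply/andP; split.
    have [/jd/ltW //|] := ltnP k (@ord_max d).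
    by move=> h; rewrite (_ : k = ord_max)//; apply/val_inj/eqP;
      rewrite eqn_leq h -ltnS ltn_ord.
  have [k0|k0] := posnP k; last by apply/ltW/jd.
  by rewrite (_ : k = ord0)//; apply: val_inj.
have M0 : (0 : R) < (d.+1 * m)%:R by rewrite ltr0n muln_gt0.
have p0 := pi_gt0 R.
have h1 := jd i l il.
have /andP[h2 h3] := le l; have /andP[h4 h5] := le i.
apply/andP; split.
  by rewrite !mulr_gt0 ?invr_gt0// ltr0z subr_gt0.
rewrite mulrAC ltr_pdivrMr// ltr_pM2l ?mulr_gt0//.
by rewrite [X in _ < X]pmulrn ltr_int PoszM; lia.
Qed.

End LatticePoint.

Lemma chebU_vanishes n alpha x : (0 < d)%N -> mdeg alpha = n ->
  Ycirc R d (n + d) x -> evalx x (chebUx R alpha) = 0.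
Proof.
move=> d0 hn [j hj <-]; rewrite evalx_chebUx -/(lattice_point (n + d) j).
have nd0 : (0 < n + d)%N by rewrite addn_gt0 d0 orbT.
set t := lattice_point _ _; have ht : RH t := RH_lattice_point hj.
rewrite (meval_eq _ (fun i => z_of_xcoord i ht)).
rewrite /chebU; case: xgetP => [P _ hP|_]; last by rewrite meval0.
have [mu hmu mud] := gaps_exists alpha.
have tinj : injective (node t) := node_lattice_point_inj nd0 hj.
have V0 : bialt (@staircase d) (node t) != 0.
  by rewrite vandermonde_neq0; apply/injectiveP.
apply: (mulIf V0); rewrite mul0r (is_chebU_bialt hP hmu)//.
apply: (@bialt_eq0 (n + d) (node t ord0 ^+ (n + d))) => //.
  by rewrite (gaps_total hmu) mud hn addn0.
by move=> i; apply: node_lattice_point_pow.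
Qed.

(** Both sides are polynomials in z that agree, after multiplication by the
    Vandermonde determinant, on nodes of the unit circle. *)
Lemma chebU_hook n (i : 'I_d.+1) : (0 < n)%N -> i != ord0 ->
  exists2 alpha, mdeg alpha = n & forall u, \prod_j u j = 1 ->
    meval (zpoint u) (chebU R alpha) =
    hook_sign _ i * meval (zpoint u) (power_remainder _ d (n + d))`_i.
Proof.
move=> n0 i0; have [alpha an gp] := hook_gaps n0 i0; exists alpha => // u u1.
pose P := hook_sign R[i] i *: (power_remainder R[i] d (n + d))`_i.
have hP : is_chebU alpha P.
  apply: bialt_is_chebU gp _ => t ht; rewrite bialt_hook ?prod_node//.
  by rewrite mevalZ.
have := @zpoint_dense _ _ (chebU R alpha - P) (@on_circle R)
  (fun k => cexpi (pi / k.+1%:R)) _ (@on_circle_div R) _ _ (@cexpi_inj_seq R)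
  _ u u1.
rewrite mevalB mevalZ => h; apply/eqP; rewrite -subr_eq0; apply/eqP; apply: h.
- by exists 0; rewrite mulr0 cexpi0.
- by move=> k; exact: cexpi_on_circle.
- by move=> k; exact: cexpi_neq0.
move=> v hv v1 vinj; have [t ht tv] := circle_nodes hv v1.
have vt : v = node t by apply/funext => j; rewrite tv.
rewrite vt in v1 vinj *; have V0 : bialt (@staircase d) (node t) != 0.
  by rewrite vandermonde_neq0; apply/injectiveP.
apply: (mulIf V0); rewrite mul0r mevalB mevalZ mulrBl.
rewrite (is_chebU_bialt (chebUP hP) gp)// bialt_hook//.
by rewrite subrr.
Qed.

End Variety.

(** * Common zeros are lattice points *)

Section Recovery.
Variables (R : realType) (d : nat).
Implicit Types (u : 'I_d.+1 -> R[i]) (x : 'rV[R]_d).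

Lemma zpoint_perm u (s : 'S_d.+1) : \prod_j u j = 1 ->
  zpoint (u \o s) =1 zpoint u.
Proof.
move=> u1; apply: nodal_poly_inj; rewrite -!nodal_polyE//.
  by rewrite [RHS](reindex_inj (@perm_inj _ s)).
by rewrite -[RHS]u1 [RHS](reindex_inj (@perm_inj _ s)).
Qed.

(** The nodes are powers of a primitive root of unity w of order (d+1)m.
    Equality of their m-th powers makes the exponents congruent modulo d + 1,
    and the product 1 makes the sum of the exponents divisible by (d+1)m. *)
Lemma nodes_lattice_point m u c : (0 < m)%N -> injective u ->
  \prod_j u j = 1 -> (forall j, u j ^+ m = c) ->
  exists2 j, Lambda d m j & zpoint u =1 zpoint (node (lattice_point R m j)).
Proof.
move=> m0 uinj u1 uc; pose M := (d.+1 * m)%N.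
have M0 : (0 < M)%N by rewrite muln_gt0.
have MR : (M%:R : R) != 0 by rewrite pnatr_eq0 -lt0n.
pose w := cexpi (2 * pi / M%:R : R).
have wprim : M.-primitive_root w := cexpi_primitive_root R M0.
(* c^(d+1) is the product of the u_j ^ m. *)
have cN : c ^+ d.+1 = 1.
  rewrite -(expr1n _ m) -u1 -prodrXl -[X in _ ^+ X = _](card_ord d.+1).
  rewrite -prodr_const.
  by apply: eq_bigr => j _; rewrite uc.
have /(fun h => choice h)[k uk] : forall j, exists k : 'I_M, u j = w ^+ k.
  move=> j; have [|k ->] := prim_rootP wprim (x := u j); last by exists k.
  by rewrite /M mulnC exprM uc.
have kinj : injective (fun j => (k j : nat)%:Z).
  by move=> i j [] kij; apply: uinj; rewrite !uk kij.
have /dvdnP[r hr] : (M %| \sum_j k j)%N.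
  rewrite (prim_order_dvd wprim) -prodrXr; apply/eqP; rewrite -[RHS]u1.
  by apply: eq_bigr => j _; rewrite uk.
have [||k' [k'inj k'M k's k'E]] := @balanced_representatives d M _ r kinj.
- by move=> i j; have := ltn_ord (k i); lia.
- by rewrite -PoszM -hr; elim/big_rec2: _ => //= j a b _ ->; rewrite PoszD.
have [s hs] := decreasing_reordering k'inj.
have wk' j : u j = cexpi (2 * pi / M%:R * (k' j)%:~R).
  have [e he] := k'E j; rewrite uk /w -cexpiMn -[_ *+ k j]mulr_natr.
  rewrite [(k j)%:R]pmulrn he intrD intrM mulrDr cexpiD -[RHS]mulr1.
  congr (_ * _).
  rewrite [X in cexpi X](_ : _ = 2 * pi * e%:~R) ?cexpi_turns//.
  by rewrite -pmulrn; field.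
pose j : 'rV[int]_d.+1 := \row_i k' (s i).
have jnode i : node (lattice_point R m j) i = u (s i).
  by rewrite node_lattice_point mxE wk'.
exists j; last first.
  move=> i; rewrite -(zpoint_perm s u1); congr (_ * _).
  by apply: eq_bigr => J _; apply: eq_bigr => l _; rewrite jnode.
split.
- split=> [|a b].
    under eq_bigr do rewrite mxE.
    by rewrite -[RHS]k's [RHS](reindex_inj (@perm_inj _ s)).
  have kmod a' b' : (k a' = k b' %[mod d.+1])%N.
    have : w ^+ (k a' * m) == w ^+ (k b' * m) by rewrite !exprM -!uk !uc.
    by rewrite (eq_prim_root_expr wprim) /M -!muln_modl eqn_pmul2r// => /eqP.
  apply/eqP; rewrite !mxE eqz_mod_dvd.
  have [e he] := k'E (s a); have [f hf] := k'E (s b).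
  have := congr1 Posz (kmod (s a) (s b)); rewrite -!modz_nat he hf => /eqP.
  rewrite eqz_mod_dvd.
  have -> : k' (s a) + e * M%:Z - (k' (s b) + f * M%:Z) =
      k' (s a) - k' (s b) + (e - f) * m%:Z * d.+1%:Z by rewrite /M PoszM; ring.
  by rewrite rpredDr // dvdz_mull.
- by move=> a b ab; rewrite !mxE; apply: hs.
- by rewrite !mxE -PoszM addrC -ltrBlDr; apply: k'M.
Qed.

Lemma chebU_common_zero n x : (0 < n)%N ->
  (forall alpha : multinom d, mdeg alpha = n -> evalx x (chebUx R alpha) = 0) ->
  Ycirc R d (n + d) x.
Proof.
move=> n0 hx; have nd0 : (0 < n + d)%N by rewrite addn_gt0 n0.
pose z i := meval (fun k => (x 0 k)%:C%C) (z_of_x R i).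
have [u [u1 uz]] := nodal_poly_split z.
have [i i0|uinj [c uc]] := nodes_of_zero_remainder nd0 u1.
  have [alpha an /(_ u u1)] := chebU_hook R n0 i0.
  have e : meval z (chebU R alpha) = 0 by rewrite -(hx alpha an) evalx_chebUx.
  rewrite (meval_eq (chebU R alpha) uz) e => /esym/eqP.
  by rewrite mulf_eq0 (negbTE (hook_sign_neq0 _ _)) => /eqP.
have [j hj ju] := nodes_lattice_point nd0 uinj u1 uc.
exists j => //; rewrite -/(lattice_point R (n + d) j).
have ht := RH_lattice_point R hj.
apply/rowP => i; apply: (@complexI R).
rewrite xcoordE// -[RHS](x_of_zK (fun k => (x 0 k)%:C%C)); congr (x_of_z _ _).
by apply/funext => k; rewrite zcoordE -ju uz.
Qed.

Lemma ideal_variety (S : set (mpoly d R[i])) :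
  variety (ideal_span S) = [set x | forall p, S p -> evalx x p = 0]%classic.
Proof.
apply/seteqP; split=> x /= hx p.
  move=> Sp; apply: hx; exists [:: (1, p)]; last by rewrite big_seq1 mul1r.
  by move=> q; rewrite inE => /eqP ->.
move=> [s hs ->]; rewrite /evalx raddf_sum big_seq big1// => q qs /=.
rewrite mevalM; have := hx _ (hs q qs); rewrite /evalx => ->; exact: mulr0.
Qed.

End Recovery.

Local Open Scope classical_set_scope.

Theorem theorem5p7 (R : realType) (d n : nat) (hd : (0 < d)%N) (hn : (0 < n)%N) :
  Ycirc R d (n + d) = variety (ideal_span (chebU_family R d n)) /\
  Ycirc R d (n + d) =
    [set x : 'rV[R]_d | forall alpha : multinom d,
       mdeg alpha = n -> evalx x (chebUx R alpha) = 0].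
Proof.
have H : Ycirc R d (n + d) = [set x : 'rV[R]_d | forall alpha : multinom d,
       mdeg alpha = n -> evalx x (chebUx R alpha) = 0].
  apply/seteqP; split=> x /=; last exact: chebU_common_zero.
  by move=> hx alpha an; exact: chebU_vanishes hx.
split=> //; rewrite H ideal_variety; apply/seteqP; split=> x /= hx.
  by move=> _ [alpha an <-]; exact: hx.
by move=> alpha an; apply: hx; exists alpha.
Qed.
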